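(* Let $\mathcal{A}$ be a $C^*$-algebra that is an ideal in its second dual $\mathcal{A}^{**}$. Let $\tau$ be a normal semi-finite trace on $\mathcal{A}^{**}$ whose restriction $\tau|_{\mathcal{A}}$ to $\mathcal{A}$ is faithful. Then each 2-local derivation $\Delta:\mathcal{A}\to\mathcal{A}$ is a derivation.
   Context: The second dual $\mathcal{A}^{**}$ of a $C^*$-algebra $\mathcal{A}$ is a von Neumann algebra under the Arens product (the two Arens products coincide); $\mathcal{A}$ is regarded as a subalgebra of $\mathcal{A}^{**}$ via the canonical embedding, and ''ideal'' means two-sided ideal. A (bounded) derivation on $\mathcal{A}$ is a (bounded) linear map $D:\mathcal{A}\to\mathcal{A}$ with $D(ab)=aD(b)+D(a)b$ for all $a,b\in\mathcal{A}$. A 2-local derivation on $\mathcal{A}$ is a mapping $\Delta:\mathcal{A}\to\mathcal{A}$ (not assumed linear or continuous) such that for each $a,b\in\mathcal{A}$ there is a bounded derivation $D_{a,b}:\mathcal{A}\to\mathcal{A}$ with $\Delta(a)=D_{a,b}(a)$ and $\Delta(b)=D_{a,b}(b)$. For a von Neumann algebra $\mathscr{M}$ with positive cone $\mathscr{M}_+$, a trace on $\mathscr{M}$ is a map $\tau:\mathscr{M}_+\to[0,+\infty]$ with $\tau(a+b)=\tau(a)+\tau(b)$ for $a,b\in\mathscr{M}_+$, $\tau(\lambda a)=\lambda\tau(a)$ for $a\in\mathscr{M}_+$, $\lambda\ge 0$ (with $0\cdot(+\infty)=0$), and $\tau(a^*a)=\tau(aa^* )$ for all $a\in\mathscr{M}$.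 It is semi-finite if for every non-zero $a\in\mathscr{M}_+$ there is a non-zero $b\in\mathscr{M}_+$ with $\tau(b)<+\infty$ and $b<a$ (i.e. $b\le a$, $b\ne a$); normal if $\tau(\sup_\alpha a_\alpha)=\sup_\alpha\tau(a_\alpha)$ for every bounded increasing net $(a_\alpha)$ in $\mathscr{M}_+$. The restriction $\tau|_{\mathcal{A}}$ is faithful if $\tau(a)=0$ implies $a=0$ for every positive $a\in\mathcal{A}$. *)

(* Defs.v *)
From HB Require Import structures.
From mathcomp Require Import all_boot all_order all_algebra.
From mathcomp Require Import complex.
From mathcomp Require Import boolp classical_sets functions reals ereal.
From mathcomp Require Import topology normedtype.
Set Implicit Arguments.
Unset Strict Implicit.
Unset Printing Implicit Defensive.
Import Order.TTheory GRing.Theory Num.Theory.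
Import numFieldNormedType.Exports.
Local Open Scope classical_set_scope.
Local Open Scope complex_scope.
Local Open Scope ring_scope.

(* Norms of a normedModType R[i] are nonnegative reals seen in R[i]. *)
Definition bounded_map (R : realType) (E F : normedModType R[i]) (f : E -> F) :=
  exists M : R, forall x, `|f x| <= M%:C * `|x|.

Lemma real_complexD (R : realType) (a b : R) : (a + b)%:C = a%:C + b%:C.
Proof. exact: rmorphD. Qed.

Lemma real_complexM (R : realType) (a b : R) : (a * b)%:C = a%:C * b%:C.
Proof. exact: rmorphM. Qed.

Section Dual.
Variables (R : realType) (E : normedModType R[i]).
Implicit Types f g : E -> R[i]^o.

Definition dual_pred : {pred (E -> R[i]^o)} :=
  mem [set f : E -> R[i]^o | linear f /\ bounded_map f].

Record dual := Dual { dual_fun :> E -> R[i]^o; _ : dual_fun \in dual_pred }.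

HB.instance Definition _ := [isSub for dual_fun].
HB.instance Definition _ := [Choice of dual by <:].

Lemma bounded_map_ge0 f : bounded_map f ->
  exists2 M : R, 0 <= M & forall x, `|f x| <= M%:C * `|x|.
Proof.
move=> [M fM]; exists `|M|; first exact: normr_ge0.
move=> x; apply: (le_trans (fM x)); rewrite ler_wpM2r// lecR.
exact: ler_norm.
Qed.

Lemma dual_pred_submod : submod_closed dual_pred.
Proof.
split=> [|a f g].
  rewrite inE; split; first by move=> k x y; rewrite /= scaler0 addr0.
  by exists 0 => x; rewrite mul0r normr0.
rewrite !inE => -[lf /bounded_map_ge0[M M0 fM]] [lg /bounded_map_ge0[N N0 gN]].
split.
  move=> k x y.
  rewrite !fctE lf lg !scalerDr !scalerA [a * k]mulrC.
  by rewrite addrACA.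
exists (complex.Re `|a| * M + N) => x.
have Ra : (complex.Re `|a|)%:C = `|a| by exact/RRe_real/normr_real.
rewrite real_complexD real_complexM Ra mulrDl (le_trans (ler_normD _ _))// lerD//.
by rewrite normrZ -mulrA ler_wpM2l.
Qed.

HB.instance Definition _ :=
  GRing.isSubmodClosed.Build _ _ dual_pred dual_pred_submod.
HB.instance Definition _ := [SubChoice_isSubLmodule of dual by <:].

Lemma dual_linear (f : dual) : linear f.
Proof. by case: f => f /=; rewrite inE => -[]. Qed.

Lemma dual_bounded (f : dual) : bounded_map f.
Proof. by case: f => f /=; rewrite inE => -[]. Qed.

Lemma dualD (f : dual) x y : f (x + y) = f x + f y.
Proof. by have := dual_linear f 1 x y; rewrite !scale1r. Qed.

Lemma dual0 (f : dual) : f 0 = 0.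
Proof. by apply: (@addrI _ (f 0)); rewrite -dualD !addr0. Qed.

Lemma dualZ (f : dual) k x : f (k *: x) = k * f x.
Proof. by have := dual_linear f k x 0; rewrite dual0 !addr0. Qed.

Lemma dual_addE (f g : dual) x : (f + g) x = f x + g x.
Proof. by []. Qed.

Lemma dual_scaleE k (f : dual) x : (k *: f) x = k * f x.
Proof. by []. Qed.

Lemma dual_ext (f g : dual) : (forall x, f x = g x) -> f = g.
Proof. by move=> fg; apply/val_inj/funext. Qed.

Definition mk_dual f (lf : linear f) (bf : bounded_map f) : dual :=
  Dual (mem_set (conj lf bf)).

Definition dual_values (f : dual) : set R :=
  [set complex.Re `|f x| | x in [set x : E | `|x| <= 1]].

Definition opnorm (f : dual) : R[i] := (sup (dual_values f))%:C.

Lemma Re_normE (z : R[i]) : (complex.Re `|z|)%:C = `|z|.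
Proof. exact/RRe_real/normr_real. Qed.

Lemma Re_norm_dualE (f : dual) x : (complex.Re `|f x|)%:C = `|f x|.
Proof. exact: Re_normE. Qed.

Lemma dual_values0 (f : dual) : dual_values f !=set0.
Proof. by exists (complex.Re `|f 0|), 0 => //=; rewrite normr0. Qed.

Lemma dual_values_ub (f : dual) (M : R) : 0 <= M ->
  (forall x, `|f x| <= M%:C * `|x|) -> ubound (dual_values f) M.
Proof.
move=> M0 fM _ [x /= x1 <-]; rewrite -lecR Re_norm_dualE.
by rewrite (le_trans (fM x))// ler_piMr// lecR.
Qed.

Lemma opnorm_ub (f : dual) (M : R) : 0 <= M ->
  (forall x, `|f x| <= M%:C * `|x|) -> opnorm f <= M%:C.
Proof.
move=> M0 fM; rewrite /opnorm lecR; apply: ge_sup.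
  exact: dual_values0.
exact: dual_values_ub.
Qed.

Lemma opnorm_ge (f : dual) x : `|x| <= 1 -> `|f x| <= opnorm f.
Proof.
move=> x1; rewrite -Re_norm_dualE /opnorm lecR; apply: ub_le_sup; last by exists x.
have [M M0 fM] := bounded_map_ge0 (dual_bounded f).
by exists M; exact: dual_values_ub.
Qed.

Lemma opnorm_ge0 (f : dual) : 0 <= opnorm f.
Proof.
have := @opnorm_ge f 0; rewrite normr0 dual0 normr0.
by apply; exact: ler01.
Qed.

Lemma le_opnorm (f : dual) x : `|f x| <= opnorm f * `|x|.
Proof.
have [->|x0] := eqVneq x 0; first by rewrite dual0 !normr0 mulr0.
have nx0 : 0 < `|x| by rewrite normr_gt0.
rewrite -ler_pdivrMr// mulrC.
have -> : `|x|^-1 * `|f x| = `|f (`|x|^-1 *: x)|.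
  by rewrite dualZ normrM normfV normr_id.
by apply: opnorm_ge; rewrite normfZV.
Qed.

Lemma opnormD (f g : dual) : opnorm (f + g) <= opnorm f + opnorm g.
Proof.
rewrite -real_complexD; apply: opnorm_ub.
  by rewrite -lecR real_complexD addr_ge0// opnorm_ge0.
move=> x; rewrite real_complexD mulrDl dual_addE (le_trans (ler_normD _ _))//.
by rewrite lerD// le_opnorm.
Qed.

Lemma opnormZ_le k (f : dual) : opnorm (k *: f) <= `|k| * opnorm f.
Proof.
rewrite -[`|k|]Re_normE -real_complexM; apply: opnorm_ub.
  by rewrite -lecR real_complexM mulr_ge0 ?opnorm_ge0// Re_normE.
move=> x; rewrite real_complexM Re_normE dual_scaleE normrM -mulrA.
by rewrite ler_wpM2l// le_opnorm.
Qed.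

Lemma opnorm0 : opnorm 0 = 0.
Proof.
apply/eqP; rewrite eq_le opnorm_ge0 andbT; apply: (@opnorm_ub _ 0) => // x.
by rewrite /= mul0r normr0.
Qed.

Lemma opnormZ k (f : dual) : opnorm (k *: f) = `|k| * opnorm f.
Proof.
apply/eqP; rewrite eq_le opnormZ_le/=.
have [->|k0] := eqVneq k 0; first by rewrite normr0 mul0r opnorm_ge0.
rewrite -ler_pdivlMl ?normr_gt0//.
rewrite -{1}[f](scalerK k0) (le_trans (opnormZ_le _ _))//.
by rewrite normfV.
Qed.

Lemma opnorm_eq0 (f : dual) : opnorm f = 0 -> f = 0.
Proof.
move=> f0; apply: dual_ext => x; apply/eqP; rewrite -normr_le0.
by rewrite (le_trans (le_opnorm f x))// f0 mul0r.
Qed.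

HB.instance Definition _ :=
  @Lmodule_isNormed.Build R[i] dual opnorm opnormD opnormZ opnorm_eq0.

Lemma dual_normE (f : dual) : `|f| = opnorm f.
Proof. by []. Qed.

Lemma dual_le_norm (f : dual) x : `|f x| <= `|f| * `|x|.
Proof. exact: le_opnorm. Qed.

End Dual.

Section BidualEmbedding.
Variables (R : realType) (E : normedModType R[i]).

Lemma eval_linear (x : E) : linear (fun f : dual E => f x : R[i]^o).
Proof. by []. Qed.

Lemma eval_bounded (x : E) : bounded_map (fun f : dual E => f x : R[i]^o).
Proof.
exists (complex.Re `|x|) => f.
rewrite (RRe_real (normr_real _)) mulrC; exact: le_opnorm.
Qed.

Definition bidual_emb (x : E) : dual (dual E) :=
  mk_dual (eval_linear x) (eval_bounded x).

End BidualEmbedding.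

(* The operations of a *-algebra without unit, which MathComp rings do not cover. *)
HB.mixin Record hasMulStar (V : Type) := {
  amul : V -> V -> V;
  astar : V -> V
}.

#[short(type="starLmodType")]
HB.structure Definition StarLmodule (R : realType) :=
  {V of GRing.Lmodule R[i] V & hasMulStar V}.

Notation "x ** y" := (amul x y) (at level 40, left associativity) : ring_scope.

HB.mixin Record isCstarAlgebra (R : realType) A
    & CompleteNormedModule R[i] A & hasMulStar A := {
  amulA : forall a b c : A, a ** (b ** c) = a ** b ** c;
  amul_linearl : forall (k : R[i]) (a b c : A),
    (k *: a + b) ** c = k *: (a ** c) + b ** c;
  amul_linearr : forall (k : R[i]) (a b c : A),
    a ** (k *: b + c) = k *: (a ** b) + a ** c;
  astar_antilinear : forall (k : R[i]) (a b : A),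
    astar (k *: a + b) = conjc k *: astar a + astar b;
  astarK : forall a : A, astar (astar a) = a;
  astarM : forall a b : A, astar (a ** b) = astar b ** astar a;
  amul_norm : forall a b : A, `|a ** b| <= `|a| * `|b|;
  cstar_norm : forall a : A, `|astar a ** a| = `|a| ^+ 2
}.

#[short(type="cstarAlgType")]
HB.structure Definition CstarAlgebra (R : realType) :=
  {A of CompleteNormedModule R[i] A & hasMulStar A & isCstarAlgebra R A}.

Section Arens.
Variables (R : realType) (A : cstarAlgType R).
Implicit Types (a b : A) (f : dual A) (P Q : dual (dual A)).

Lemma astar_norm_le a : `|a| <= `|astar a|.
Proof.
have [->|a0] := eqVneq a 0; first by rewrite normr0.
have na0 : 0 < `|a| by rewrite normr_gt0.
by rewrite -(ler_pM2r na0) -expr2 -cstar_norm; exact: amul_norm.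
Qed.

Lemma astar_norm a : `|astar a| = `|a|.
Proof.
by apply/eqP; rewrite eq_le astar_norm_le andbT -{2}[a]astarK astar_norm_le.
Qed.

Lemma dual_act_linear f a : linear (fun b => f (a ** b)).
Proof. by move=> k b c; rewrite amul_linearr dual_linear. Qed.

Lemma dual_act_bound f a b : `|f (a ** b)| <= `|f| * `|a| * `|b|.
Proof.
by rewrite (le_trans (dual_le_norm _ _))// -mulrA ler_wpM2l//; exact: amul_norm.
Qed.

Lemma dual_act_bounded f a : bounded_map (fun b => f (a ** b)).
Proof.
exists (complex.Re (`|f| * `|a|)) => b.
by rewrite RRe_real ?dual_act_bound// realM ?normr_real.
Qed.

(* (f . a)(b) = f(ab) *)
Definition dual_act f a : dual A :=
  mk_dual (dual_act_linear f a) (dual_act_bounded f a).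

Lemma dual_act_norm f a : `|dual_act f a| <= `|f| * `|a|.
Proof.
have fa : `|f| * `|a| \is Num.real by rewrite realM ?normr_real.
rewrite -(RRe_real fa); apply: opnorm_ub.
  by rewrite -lecR (RRe_real fa) mulr_ge0.
by move=> b; rewrite (RRe_real fa) dual_act_bound.
Qed.

Lemma bidual_act_linear Q f : linear (fun a => Q (dual_act f a)).
Proof.
move=> k a b; rewrite -dual_linear; congr (Q _); apply: dual_ext => c.
by rewrite /= amul_linearl dual_linear.
Qed.

Lemma bidual_act_bound Q f a : `|Q (dual_act f a)| <= `|Q| * `|f| * `|a|.
Proof.
by rewrite (le_trans (dual_le_norm _ _))// -mulrA ler_wpM2l// dual_act_norm.
Qed.

Lemma bidual_act_bounded Q f : bounded_map (fun a => Q (dual_act f a)).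
Proof.
exists (complex.Re (`|Q| * `|f|)) => a.
by rewrite RRe_real ?bidual_act_bound// realM ?normr_real.
Qed.

(* (Q . f)(a) = Q(f . a) *)
Definition bidual_act Q f : dual A :=
  mk_dual (bidual_act_linear Q f) (bidual_act_bounded Q f).

Lemma bidual_act_norm Q f : `|bidual_act Q f| <= `|Q| * `|f|.
Proof.
have Qf : `|Q| * `|f| \is Num.real by rewrite realM ?normr_real.
rewrite -(RRe_real Qf); apply: opnorm_ub.
  by rewrite -lecR (RRe_real Qf) mulr_ge0.
by move=> b; rewrite (RRe_real Qf) bidual_act_bound.
Qed.

Lemma arens_linear P Q : linear (fun f => P (bidual_act Q f)).
Proof.
move=> k f g.
suff -> : bidual_act Q (k *: f + g) = k *: bidual_act Q f + bidual_act Q g.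
  exact: dual_linear.
apply: dual_ext => a.
have E : dual_act (k *: f + g) a = k *: dual_act f a + dual_act g a.
  exact: dual_ext.
by rewrite /= E dual_linear.
Qed.

Lemma arens_bounded P Q : bounded_map (fun f => P (bidual_act Q f)).
Proof.
exists (complex.Re (`|P| * `|Q|)) => f.
rewrite RRe_real ?realM ?normr_real// (le_trans (dual_le_norm _ _))//.
by rewrite -mulrA ler_wpM2l// bidual_act_norm.
Qed.

(* The first Arens product (P Q)(f) = P(Q . f); for C*-algebras the second one
   coincides with it. *)
Definition arens_mul P Q : dual (dual A) :=
  mk_dual (arens_linear P Q) (arens_bounded P Q).

Lemma dual_star_linear f : linear (fun a => conjc (f (astar a)) : R[i]^o).
Proof.
by move=> k a b; rewrite astar_antilinear dual_linear rmorphD rmorphM /= conjcK.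
Qed.

Lemma dual_star_bound f a : `|conjc (f (astar a))| <= `|f| * `|a|.
Proof. by rewrite normcJ -(astar_norm a) dual_le_norm. Qed.

Lemma dual_star_bounded f : bounded_map (fun a => conjc (f (astar a)) : R[i]^o).
Proof.
exists (complex.Re `|f|) => a.
by rewrite RRe_real ?normr_real// dual_star_bound.
Qed.

Definition dual_star f : dual A :=
  mk_dual (dual_star_linear f) (dual_star_bounded f).

Lemma dual_star_norm f : `|dual_star f| <= `|f|.
Proof.
rewrite -(RRe_real (normr_real f)); apply: opnorm_ub.
  by rewrite -lecR (RRe_real (normr_real f)); exact: normr_ge0.
by move=> b; rewrite (RRe_real (normr_real f)) dual_star_bound.
Qed.

Lemma bidual_star_linear P : linear (fun f => conjc (P (dual_star f)) : R[i]^o).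
Proof.
move=> k f g.
have -> : dual_star (k *: f + g) = conjc k *: dual_star f + dual_star g.
  by apply: dual_ext => a; rewrite /= rmorphD rmorphM.
by rewrite dual_linear rmorphD rmorphM /= conjcK.
Qed.

Lemma bidual_star_bounded P :
  bounded_map (fun f => conjc (P (dual_star f)) : R[i]^o).
Proof.
exists (complex.Re `|P|) => f.
rewrite RRe_real ?normr_real// normcJ (le_trans (dual_le_norm _ _))//.
by rewrite ler_wpM2l// dual_star_norm.
Qed.

Definition bidual_star P : dual (dual A) :=
  mk_dual (bidual_star_linear P) (bidual_star_bounded P).

HB.instance Definition _ :=
  hasMulStar.Build (dual (dual A)) arens_mul bidual_star.

End Arens.

Section EmbeddingMorphism.
Variables (R : realType) (A : cstarAlgType R).

Lemma bidual_embM (a b : A) :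
  bidual_emb (a ** b) = bidual_emb a ** bidual_emb b.
Proof. exact: dual_ext. Qed.

Lemma bidual_emb_star (a : A) : bidual_emb (astar a) = astar (bidual_emb a).
Proof. by apply: dual_ext => f /=; rewrite conjcK. Qed.

Lemma bidual_emb_linear : linear (@bidual_emb R A).
Proof. by move=> k a b; apply: dual_ext => f; exact: dual_linear. Qed.

End EmbeddingMorphism.

Section Trace.
Variables (R : realType) (V : starLmodType R).
Implicit Types (J : set V) (x y : V) (tau : V -> \bar R).

Definition two_sided_ideal J :=
  [/\ J 0, forall (k : R[i]) x y, J x -> J y -> J (k *: x + y)
    & forall x y, J x -> J (x ** y) /\ J (y ** x)].

Definition positive x := exists y, x = astar y ** y.

Definition pos_le x y := positive (y - x).

(* A trace is a function on the positive cone; it is represented here by a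
   function on the whole algebra whose values outside of the cone are not
   constrained. *)
Record is_trace tau : Prop := {
  trace_ge0 : forall x, positive x -> (0 <= tau x)%E;
  traceD : forall x y, positive x -> positive y ->
    tau (x + y) = (tau x + tau y)%E;
  traceZ : forall (k : R) x, 0 <= k -> positive x ->
    tau (k%:C *: x) = (k%:E * tau x)%E;
  trace_star : forall x, tau (astar x ** x) = tau (x ** astar x)
}.

Definition semifinite tau :=
  forall x, positive x -> x <> 0 ->
  exists y, [/\ positive y, y <> 0, (tau y < +oo)%E, pos_le y x & y <> x].

Definition is_supremum (S : set V) s :=
  (forall x, S x -> pos_le x s) /\
  (forall u, (forall x, S x -> pos_le x u) -> pos_le s u).

(* A net is a family indexed by a nonempty directed preorder. Its boundedness
   is not a separate hypothesis: it follows from the existence of the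
   supremum. *)
Definition normal tau :=
  forall (I : Type) (leI : I -> I -> Prop) (x : I -> V) (s : V),
    inhabited I ->
    (forall i, leI i i) ->
    (forall i j k, leI i j -> leI j k -> leI i k) ->
    (forall i j, exists k, leI i k /\ leI j k) ->
    (forall i, positive (x i)) ->
    (forall i j, leI i j -> pos_le (x i) (x j)) ->
    is_supremum (range x) s ->
    tau s = ereal_sup (range (tau \o x)).

End Trace.

Section Derivation.
Variables (R : realType) (A : cstarAlgType R).

Definition derivation (D : A -> A) :=
  linear D /\ forall a b, D (a ** b) = a ** D b + D a ** b.

Definition two_local_derivation (Delta : A -> A) :=
  forall a b, exists D : A -> A,
    [/\ derivation D, bounded_map D, Delta a = D a & Delta b = D b].

End Derivation.

(* Main.v *)
Require Import Defs.
From mathcomp Require Import all_boot all_order all_algebra.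
From mathcomp Require Import complex.
From mathcomp Require Import boolp classical_sets functions reals ereal.
From mathcomp Require Import topology normedtype.
From mathcomp Require Import ring lra.
Local Open Scope classical_set_scope.
Local Open Scope ring_scope.
Import Order.TTheory GRing.Theory Num.Theory.
Import numFieldNormedType.Exports.
Local Open Scope complex_scope.
Set Implicit Arguments.
Unset Strict Implicit.
Unset Printing Implicit Defensive.

(* The trace plays no role: an ideal of its bidual has so many minimal projections
   (p A p = C p) that they can replace it.

   If D is a derivation, p a minimal projection and w = w p, w^* w = mu p, then
   compressing D(p x w) = k D(p) to the corner of p expresses mu p D(x) w through
   x and D(w) alone, linearly in x. For a 2-local derivation Delta, applied to the
   pairs (x, w), this shows that p Delta(.) w is linear; since the p separate
   points, Delta is linear. Its Leibniz defect d(x, y) is then antisymmetric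
   (as d(x, x) = 0), satisfies p d(x, y) w = p x d(y, w) p, and vanishes when
   xy is a multiple of y, in particular on p A x p A; these force d = 0.

   Minimal projections: by the ideal property, a x_n has a weak limit point in A
   for every bounded sequence x_n and every a in A. For a self-adjoint with
   norm 1 and h = a^2, a weak limit of h times the Cesaro means of the powers of h
   is a projection c with h c = c; c is not 0 because some functional of norm 1
   takes the value 1 on all powers of h. Decreasing sequences of projections
   stabilise, again by a weak limit, so every projection dominates a minimal one. *)

(** * Algebra in a C*-algebra; projections *)

Section CstarBasics.
Variables (R : realType) (A : cstarAlgType R).
Implicit Types (a b c p q x y : A) (k : R[i]).

Lemma amulDl a b c : (a + b) ** c = a ** c + b ** c.
Proof. by have := amul_linearl 1 a b c; rewrite !scale1r. Qed.

Lemma amulDr a b c : a ** (b + c) = a ** b + a ** c.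
Proof. by have := amul_linearr 1 a b c; rewrite !scale1r. Qed.

Lemma amul0l a : 0 ** a = 0 :> A.
Proof. by apply: (@addrI _ (0 ** a)); rewrite -amulDl !addr0. Qed.

Lemma amul0r a : a ** 0 = 0 :> A.
Proof. by apply: (@addrI _ (a ** 0)); rewrite -amulDr !addr0. Qed.

Lemma amulZl k a b : (k *: a) ** b = k *: (a ** b).
Proof. by have := amul_linearl k a 0 b; rewrite amul0l !addr0. Qed.

Lemma amulZr k a b : a ** (k *: b) = k *: (a ** b).
Proof. by have := amul_linearr k a b 0; rewrite amul0r !addr0. Qed.

Lemma amulNl a b : (- a) ** b = - (a ** b).
Proof. by apply: (@addrI _ (a ** b)); rewrite -amulDl !subrr amul0l. Qed.

Lemma amulNr a b : a ** (- b) = - (a ** b).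
Proof. by apply: (@addrI _ (a ** b)); rewrite -amulDr !subrr amul0r. Qed.

Lemma amulBl a b c : (a - b) ** c = a ** c - b ** c.
Proof. by rewrite amulDl amulNl. Qed.

Lemma amulBr a b c : a ** (b - c) = a ** b - a ** c.
Proof. by rewrite amulDr amulNr. Qed.

Lemma astarD a b : astar (a + b) = astar a + astar b.
Proof. by have := astar_antilinear 1 a b; rewrite conjc1 !scale1r. Qed.

Lemma astar0 : astar 0 = 0 :> A.
Proof. by apply: (@addrI _ (astar 0)); rewrite -astarD !addr0. Qed.

Lemma astarZ k a : astar (k *: a) = conjc k *: astar a.
Proof. by have := astar_antilinear k a 0; rewrite astar0 !addr0. Qed.

Lemma astarN a : astar (- a) = - astar a.
Proof. by apply: (@addrI _ (astar a)); rewrite -astarD !subrr astar0. Qed.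

Lemma astarB a b : astar (a - b) = astar a - astar b.
Proof. by rewrite astarD astarN. Qed.

Lemma cstar_eq0 a : astar a ** a = 0 -> a = 0.
Proof.
move=> aa0; apply/eqP; rewrite -normr_eq0 -sqrf_eq0 -cstar_norm aa0.
by rewrite normr0.
Qed.

Definition projection p := astar p = p /\ p ** p = p.

(** Minimality is expressed by a one-dimensional corner, the form used in computations;
    [indecomposable_minimal] derives it from the order-theoretic form. *)
Definition minimal_projection p :=
  [/\ projection p, p <> 0 & forall x, exists k, p ** x ** p = k *: p].

End CstarBasics.

(** * Derivations and minimal projections *)

Section Derivations.
Variables (R : realType) (A : cstarAlgType R) (D : A -> A).
Hypothesis derD : derivation D.
Implicit Types (p w x y : A) (k : R[i]).

Lemma derivationM x y : D (x ** y) = x ** D y + D x ** y.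
Proof. by case: derD. Qed.

Lemma derivation0 : D 0 = 0.
Proof. by have := derivationM 0 0; rewrite amul0l amul0l amul0r addr0. Qed.

Lemma derivationZ k x : D (k *: x) = k *: D x.
Proof. by case: derD => lD _; have := lD k x 0; rewrite derivation0 !addr0. Qed.

(** Multiply D(p) = p D(p) + D(p) p by p on the left. *)
Lemma derivation_corner p : p ** p = p -> p ** D p ** p = 0.
Proof.
move=> pp; apply: (@addrI _ (p ** D p)); rewrite addr0.
by have /(congr1 (amul p)) := derivationM p p; rewrite pp amulDr !amulA pp.
Qed.

(* As [p x w = k p], this is [D (p x w) = k D p] compressed to the corner of [p],
   where [p D(p) p = 0]. *)
Lemma derivation_minimal p x w : minimal_projection p -> w ** p = w ->
  p ** D x ** w + p ** x ** D w ** p + p ** D p ** x ** w = 0.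
Proof.
move=> [[_ pp] _ /(_ (x ** w))[k pk]] wp.
have pxw : p ** x ** w = k *: p by rewrite -pk !amulA -(amulA _ w) wp.
have := congr1 (fun z => p ** D z ** p) pxw.
rewrite derivationZ amulZr amulZl derivation_corner// scaler0.
rewrite !derivationM !(amulDl, amulDr) !amulA pp -!(amulA _ w p) wp => <-.
by rewrite addrCA addrA.
Qed.

(** Multiply D(w) = w D(p) + D(w) p by w^* on the left. This trades D(p) for D(w). *)
Lemma derivation_isometry p w k : projection p -> w ** p = w ->
    astar w ** w = k *: p ->
  k *: (p ** D p) = astar w ** D w - astar w ** D w ** p.
Proof.
move=> [sp pp] wp wwk.
rewrite -{2}wp derivationM amulDr !amulA wwk amulZl.
by rewrite addrK.
Qed.

End Derivations.

(** * 2-local derivations: linearity, then the Leibniz rule *)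

Section TwoLocal.
Variables (R : realType) (A : cstarAlgType R) (Delta : A -> A).
Hypothesis locD : two_local_derivation Delta.
Hypothesis minA :
  forall a : A, a <> 0 -> exists2 p, minimal_projection p & a ** p <> 0.
Implicit Types (p w x y : A) (k : R[i]).

Lemma minimal_projection_cancel x :
  (forall p, minimal_projection p -> p ** x = 0) -> x = 0.
Proof.
move=> px0; rewrite -[x]astarK; case: (pselect (astar x = 0)) => [->|x0].
  exact: astar0.
have [p mp] := minA x0; case: (mp) => -[sp _] _ _.
by rewrite -sp -astarM px0// astar0.
Qed.

(* The right-hand side is linear in [x]: this is what makes [Delta] linear. *)
Lemma two_local_minimal p x w k : minimal_projection p -> w ** p = w ->
    astar w ** w = k *: p ->
  k *: (p ** Delta x ** w) =
  (astar w ** Delta w ** p - astar w ** Delta w) ** x ** w -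
  k *: (p ** x ** Delta w ** p).
Proof.
move=> mp wp wwk; have [D [dD _ -> ->]] := locD x w.
have /(congr1 ( *:%R k)) := derivation_minimal dD x mp wp.
rewrite scaler0 !scalerDr.
have -> : k *: (p ** D p ** x ** w) = (k *: (p ** D p)) ** x ** w.
  by rewrite !amulZl.
rewrite (derivation_isometry dD _ wp wwk); last by case: mp.
move=> /eqP; rewrite -addrA addr_eq0 => /eqP ->.
by rewrite opprD addrC -[astar w ** _ ** _ - _]opprB !amulNl.
Qed.

(** The linearity defect z is tested against w = z^* p, where w^* w = mu p. Linearity of the
    right-hand side of [two_local_minimal] gives 0 = mu p z w = mu^2 p, so w = 0 and p z = 0. *)
Lemma two_local_linear : linear Delta.
Proof.
move=> k x y; apply/eqP; rewrite -subr_eq0; apply/eqP.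
set z : A := _ - _.
apply: minimal_projection_cancel => p mp; case: (mp) => -[sp pp] p0 pA.
have [mu zmu] := pA (z ** astar z).
have szp : astar (astar z ** p) = p ** z by rewrite astarM astarK sp.
have wp : astar z ** p ** p = astar z ** p by rewrite -amulA pp.
have wwmu : astar (astar z ** p) ** (astar z ** p) = mu *: p.
  by rewrite szp -zmu !amulA.
suff mu0 : mu = 0.
  rewrite -szp (_ : astar z ** p = 0) ?astar0//; apply: cstar_eq0.
  by rewrite wwmu mu0 scale0r.
have lin u := two_local_minimal u mp wp wwmu.
set w := astar z ** p in wp wwmu lin szp.
set b := astar w ** _ ** p - _ in lin; move: b lin => b lin.
have linG : linear (fun u : A => b ** u ** w - mu *: (p ** u ** Delta w ** p)).
  move=> l u v; rewrite !(amulDr, amulZr, amulDl, amulZl).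
  rewrite [mu *: (_ + _)]scalerDr opprD addrACA.
  by rewrite scalerBr !scalerA mulrC.
have : mu *: (p ** z ** w) = 0.
  rewrite [in p ** z]/z !(amulBr, amulDr, amulZr, amulBl, amulDl, amulZl).
  rewrite !(scalerBr, scalerDr) [mu *: (k *: _)]scalerA [mu * k]mulrC -scalerA.
  by rewrite !lin linG subrr.
rewrite -szp wwmu scalerA => /eqP; rewrite scaler_eq0 mulf_eq0 orbb.
by move=> /orP[/eqP//|/eqP].
Qed.

Let defect x y := Delta (x ** y) - x ** Delta y - Delta x ** y.

Lemma two_localD x y : Delta (x + y) = Delta x + Delta y.
Proof. by have := two_local_linear 1 x y; rewrite !scale1r. Qed.

Lemma two_local_square x : Delta (x ** x) = x ** Delta x + Delta x ** x.
Proof. by have [D [dD _ -> ->]] := locD x (x ** x); exact: derivationM. Qed.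

Lemma two_local0 : Delta 0 = 0.
Proof. by apply: (@addrI _ (Delta 0)); rewrite -two_localD !addr0. Qed.

Lemma two_localZ k x : Delta (k *: x) = k *: Delta x.
Proof. by have := two_local_linear k x 0; rewrite two_local0 !addr0. Qed.

Lemma defectDl x x' y : defect (x + x') y = defect x y + defect x' y.
Proof.
rewrite /defect two_localD !amulDl two_localD !opprD.
by rewrite (addrACA (Delta _)) [LHS]addrACA.
Qed.

Lemma defectDr x y y' : defect x (y + y') = defect x y + defect x y'.
Proof.
rewrite /defect two_localD !amulDr two_localD !opprD.
by rewrite (addrACA (Delta _)) [LHS]addrACA.
Qed.

(** One derivation controls only two values of [Delta]; here the third, at x y = k y, follows from
    homogeneity. *)
Lemma defect_span x y k : x ** y = k *: y -> defect x y = 0.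
Proof.
have [D [dD _ Dx Dy]] := locD x y; move=> xy.
rewrite /defect xy two_localZ Dx Dy -(derivationZ dD) -xy (derivationM dD).
by rewrite addrAC addrK subrr.
Qed.

(** Polarise d(z, z) = 0, which comes from the pair (z, z^2). *)
Lemma defect_anti x y : defect x y = - defect y x.
Proof.
have defect_diag z : defect z z = 0.
  by rewrite /defect two_local_square addrAC addrK subrr.
apply/eqP; rewrite -addr_eq0; apply/eqP; have := defect_diag (x + y).
by rewrite defectDl !defectDr !defect_diag add0r addr0.
Qed.

(** The identity of [derivation_minimal] with [Delta] for D. It involves three values of [Delta], so
    the pairs (x, w) and (p, w) are used separately, and p Delta(p) is eliminated after scaling by
    mu, where w^* w = mu p. *)
Lemma two_local_corner p x w : minimal_projection p -> w ** p = w ->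
  p ** Delta x ** w + p ** x ** Delta w ** p + p ** Delta p ** x ** w = 0.
Proof.
move=> mp wp; case: (mp) => prp p0 pA.
have [mu] := pA (astar w ** w); rewrite amulA -(amulA _ w p) wp.
rewrite (_ : p ** astar w = astar w); last first.
  by rewrite -[in RHS]wp astarM; case: prp => ->.
move=> wwmu; have [mu0|/eqP mu0] := pselect (mu = 0).
  have -> : w = 0 by apply: cstar_eq0; rewrite wwmu mu0 scale0r.
  by rewrite two_local0 !(amul0r, amul0l) !addr0.
have pDp : mu *: (p ** Delta p) = astar w ** Delta w - astar w ** Delta w ** p.
  have [D [dD _ -> ->]] := locD p w.
  exact: derivation_isometry.
apply: (scalerI mu0); rewrite scaler0 !scalerDr (two_local_minimal x mp wp wwmu).
rewrite -(opprB (_ ** p)) in pDp.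
have -> : mu *: (p ** Delta p ** x ** w) = mu *: (p ** Delta p) ** x ** w.
  by rewrite !amulZl.
by rewrite pDp !amulNl subrK subrr.
Qed.

(** Subtract the corner identities for (x, y w) and (x y, w): both contain the term p Delta(p) x y
    w. *)
Lemma defect_shift p x y w : minimal_projection p -> w ** p = w ->
  p ** defect x y ** w = p ** x ** defect y w ** p.
Proof.
move=> mp wp.
have ywp : y ** w ** p = y ** w by rewrite -amulA wp.
have e1 := two_local_corner x mp ywp.
have e2 := two_local_corner (x ** y) mp wp.
have {e1 e2} := etrans e2 (esym e1); rewrite !amulA => /addIr e.
rewrite /defect !(amulBr, amulBl) !amulA -!(amulA _ w p) wp.
have -> : p ** Delta (x ** y) ** w = p ** Delta x ** y ** w +
    p ** x ** Delta (y ** w) ** p - p ** x ** y ** Delta w ** p.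
  by rewrite -e addrK.
by rewrite -!addrA [LHS]addrC !addrA subrK.
Qed.

(** Take x = z^* and apply the C*-identity to z p. *)
Lemma corner_cancel p z : astar p = p ->
  (forall x, p ** x ** z ** p = 0) -> z ** p = 0.
Proof.
move=> sp pz; apply: cstar_eq0; rewrite astarM sp amulA; exact: pz.
Qed.

Lemma defectr_minimal p y w : minimal_projection p -> w ** p = w ->
  defect y w ** p = 0.
Proof.
move=> mp wp; case: (mp) => -[sp pp] _ pA.
have -> : y = (y - p ** y) + p ** y by rewrite subrK.
rewrite defectDl amulDl [X in X + _](corner_cancel sp) ?add0r; last first.
  (* With y' = y - p y: p x d(y', w) p = p d(x, y') w = - p d(y', x) w = - p y' d(x, w) p, and p y'
     = 0. *)
  move=> x; rewrite -defect_shift// defect_anti amulNr amulNl defect_shift//.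
  by rewrite (amulBr p y) amulA pp subrr !amul0l oppr0.
apply: (corner_cancel sp) => x.
(* As p x = p (p x), the shift lands on d(p x, p y), where p x p y = k p y. *)
rewrite -[in p ** x]pp -(amulA p p x) -defect_shift//.
have [k pxpy] := pA x.
rewrite (@defect_span _ _ k) ?amul0r ?amul0l// amulA pxpy.
by rewrite amulZl.
Qed.

Lemma two_local_derivation_derivation : derivation Delta.
Proof.
split; first exact: two_local_linear.
move=> x y; apply/eqP; rewrite -subr_eq0 opprD addrA; apply/eqP.
rewrite -/(defect x y); apply: minimal_projection_cancel => p mp.
case: (mp) => -[sp pp] _ _.
have wp : astar (defect x y) ** p ** p = astar (defect x y) ** p.
  by rewrite -amulA pp.
(* With d the defect at (x, y) and w = d^* p, the left side p d w is w^* w; the right side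
   vanishes. *)
have := defect_shift x y mp wp.
rewrite -(amulA (p ** x)) (defectr_minimal _ mp wp) amul0r => dw.
rewrite -[p ** _]astarK astarM sp (_ : astar _ ** p = 0) ?astar0//.
by apply: cstar_eq0; rewrite astarM astarK sp.
Qed.

End TwoLocal.

Lemma complex_eq_Re (R : rcfType) (z : R[i]) (r : R) :
  complex.Re z = r -> `|z| <= r%:C -> z = r%:C.
Proof.
move=> Rez zr; apply/eqP; rewrite eq_complex Rez eqxx/=.
have := le_trans (normr_ge0 _) zr; rewrite ler0c => r0.
have : `|z| ^+ 2 <= r%:C ^+ 2 by apply: lerXn2r; rewrite ?nnegrE ?normr_ge0 ?ler0c.
rewrite -add_Re2_Im2 Rez -rmorphXn/= lecR gerDl => h.
by rewrite -sqrf_eq0 eq_le h sqr_ge0.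
Qed.

(** * Norming functionals *)

Section HahnBanach.
Variables (R : realType) (E : normedModType R[i]).
Implicit Types (p q : E -> R) (x y : E) (k : R).

(** Only real scalars occur, and homogeneity is an inequality, the form easily checked for infima;
    [sublinearZ] recovers equality. *)
Definition sublinear p := (forall x y, p (x + y) <= p x + p y) /\
  (forall k x, 0 <= k -> p (k%:C *: x) <= k * p x).

Lemma sublinear0 p : sublinear p -> p 0 = 0.
Proof.
move=> [pD pZ]; apply/eqP; rewrite eq_le.
have := pZ 0 0 (lexx _); rewrite mul0r scaler0 => -> /=.
by have := pD 0 0; rewrite addr0 lerDl.
Qed.

Lemma sublinearZ p k x : sublinear p -> 0 <= k -> p (k%:C *: x) = k * p x.
Proof.
move=> sp; rewrite le_eqVlt => /predU1P[<-|k0].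
  by rewrite scale0r mul0r sublinear0.
have [_ pZ] := sp; apply/eqP; rewrite eq_le (pZ _ _ (ltW k0))/=.
have := pZ k^-1 (k%:C *: x); rewrite invr_ge0 => /(_ (ltW k0)).
rewrite scalerA -real_complexM mulVf ?gt_eqF// scale1r.
by rewrite ler_pdivlMl.
Qed.

(** Common criterion for the directional infimum and for the infimum of a chain. *)
Lemma sublinear_inf (F : set (E -> R)) : F !=set0 ->
    (forall x, has_lbound [set f x | f in F]) ->
    (forall f g x y, F f -> F g -> exists2 h, F h & h (x + y) <= f x + g y) ->
    (forall f k x, 0 <= k -> F f -> exists2 h, F h & h (k%:C *: x) <= k * f x) ->
  sublinear (fun x => inf [set f x | f in F]).
Proof.
move=> [f0 Ff0] lbF FD FZ.
have ge x h : F h -> inf [set f x | f in F] <= h x.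
  by move=> Fh; apply: ge_inf => //; exists h.
have leF x r : (forall f, F f -> r <= f x) -> r <= inf [set f x | f in F].
  by move=> rF; apply: lb_le_inf; [exists (f0 x), f0 | move=> _ [f /rF ? <-]].
split=> [x y|k x].
  rewrite -lerBlDr; apply: (leF _) => f Ff; rewrite lerBlDr -lerBlDl.
  apply: (leF y) => g Fg; rewrite lerBlDl; have [h Fh] := FD f g x y Ff Fg.
  by apply: le_trans; exact: ge.
rewrite le_eqVlt => /predU1P[<-|k0].
  have [h Fh] := FZ f0 0 x (lexx _) Ff0; rewrite !mul0r.
  by apply: le_trans; exact: ge.
rewrite -ler_pdivrMl//; apply: (leF _) => f Ff; rewrite ler_pdivrMl//.
have [h Fh] := FZ f k x (ltW k0) Ff.
by apply: le_trans; exact: ge.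
Qed.

Lemma sublinearN p x : sublinear p -> - p (- x) <= p x.
Proof.
move=> sp; rewrite lerNl -subr_ge0 opprK -[leLHS](sublinear0 sp) -(subrr x) addrC.
by case: sp.
Qed.

(* The directional infimum [inf_t (p (x + t y) - t p y)] forces additivity in
   the direction [y]. *)
Lemma sublinear_dir p y : sublinear p -> exists q,
  [/\ sublinear q, forall x, q x <= p x & q (- y) <= - p y].
Proof.
move=> sp; have [pD pZ] := sp.
pose s t x := p (x + t%:C *: y) - t * p y.
pose F := [set s t | t in [set t : R | 0 <= t]].
have lbF x : has_lbound [set f x | f in F].
  exists (- p (- x)) => _ [_ [t /= t0 <-] <-]; rewrite /s lerBrDr addrC lerBlDr.
  rewrite -sublinearZ//; have := pD (x + t%:C *: y) (- x).
  by rewrite addrAC subrr add0r.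
exists (fun x => inf [set f x | f in F]); split.
- apply: sublinear_inf => //; first by exists (s 0), 0 => /=.
  + move=> _ _ x x' [t /= t0 <-] [t' /= t'0 <-].
    exists (s (t + t')); first by exists (t + t') => //=; exact: addr_ge0.
    rewrite /s real_complexD scalerDl mulrDl addrACA opprD [leRHS]addrACA.
    by rewrite lerD2r.
  + move=> _ k x k0 [t /= t0 <-].
    exists (s (k * t)); first by exists (k * t) => //=; exact: mulr_ge0.
    rewrite /s real_complexM -scalerA -scalerDr mulrBr mulrA.
    by rewrite lerD2r pZ.
- move=> x; apply: ge_inf; first exact: lbF.
  by exists (s 0); [exists 0 => /=|rewrite /s scale0r mul0r addr0 subr0].
- apply: ge_inf; first exact: lbF.
  exists (s 1); first by exists 1 => //=; exact: ler01.
  by rewrite /s scale1r addNr sublinear0// mul1r add0r.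
Qed.

(** Zorn's lemma for the reversed pointwise order; chains are bounded by their infima, finite since
    q(x) >= - q(-x) >= - p(-x). *)
Lemma minimal_sublinear p : sublinear p -> exists q,
  [/\ sublinear q, forall x, q x <= p x
    & forall r, sublinear r -> (forall x, r x <= q x) -> r = q].
Proof.
move=> sp.
pose T := {q : E -> R | sublinear q /\ forall x, q x <= p x}.
pose le (q r : T) := `[< forall x, sval r x <= sval q x >].
have [||||q qmin] := @Zorn T le.
- by move=> q; apply/asboolP.
- move=> q r s /asboolP qr /asboolP rs; apply/asboolP => x.
  exact: le_trans (qr x).
- move=> [q qp] [r rp] /asboolP/= qr /asboolP/= rq; apply: eq_exist.
  by apply/funext => x; apply/eqP; rewrite eq_le qr rq.
- move=> C totC; have [C0|C0] := pselect (C = set0).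
    by exists (exist _ p (conj sp (fun x => lexx _))); rewrite C0.
  have /set0P[q0 Cq0] : C != set0 by exact/eqP.
  pose F := [set sval q | q in C].
  have lbF x : has_lbound [set f x | f in F].
    exists (- p (- x)) => _ [_ [q Cq <-] <-].
    have [sq qp] := svalP q; apply: le_trans (sublinearN _ sq).
    by rewrite lerN2.
  have sF : sublinear (fun x => inf [set f x | f in F]).
    apply: sublinear_inf => //; first by exists (sval q0), q0.
    + move=> _ _ x y [q Cq <-] [r Cr <-].
      have [/asboolP qr|/asboolP rq] := totC q r Cq Cr.
      * exists (sval r); first by exists r.
        have [[rD _] _] := svalP r; apply: le_trans (rD _ _) _.
        by rewrite lerD2r.
      * exists (sval q); first by exists q.
        have [[qD _] _] := svalP q; apply: le_trans (qD _ _) _.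
        by rewrite lerD2l.
    + move=> _ k x k0 [q Cq <-]; exists (sval q); first by exists q.
      by have [[_ qZ] _] := svalP q; exact: qZ.
  have leF (q : T) x : C q -> inf [set f x | f in F] <= sval q x.
    by move=> Cq; apply: ge_inf => //; exists (sval q) => //; exists q.
  have Fp x : inf [set f x | f in F] <= p x.
    by apply: le_trans (leF q0 x Cq0) _; have [_] := svalP q0.
  exists (exist _ (fun x => inf [set f x | f in F]) (conj sF Fp)) => q Cq.
  by apply/asboolP => x; exact: leF.
have [sq qp] := svalP q; exists (sval q); split => // r sr rq.
have rp x : r x <= p x by apply: le_trans (rq x) (qp x).
pose r' : T := exist _ r (conj sr rp).
have qr : le q r' by exact/asboolP.
by have /(congr1 sval) := qmin r' qr.
Qed.

(** By minimality q equals its own directional infimum, so q(-y) = - q(y); an odd subadditive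
    function is additive. *)
Lemma minimal_sublinearD q : sublinear q ->
    (forall r, sublinear r -> (forall x, r x <= q x) -> r = q) ->
  forall x y, q (x + y) = q x + q y.
Proof.
move=> sq qmin.
have qN y : q (- y) = - q y.
  have [r [sr rq ry]] := sublinear_dir y sq.
  move: ry; rewrite (qmin r sr rq) => qNy.
  apply/eqP; rewrite eq_le qNy/=.
  by have := sublinearN (- y) sq; rewrite opprK.
move=> x y; apply/eqP; rewrite eq_le (proj1 sq)/=.
rewrite -lerBrDr -qN; apply: le_trans (proj1 sq _ _).
by rewrite addrK.
Qed.

(** A complex functional is recovered from its real part by f(x) = q(x) - i q(i x). *)
Lemma complex_dual (q : E -> R) : (forall x y, q (x + y) = q x + q y) ->
    (forall k x, q (k%:C *: x) = k * q x) ->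
    (forall x, (q x)%:C <= `|x|) ->
  exists2 f : dual E, forall x, complex.Re (f x) = q x & forall x, `|f x| <= `|x|.
Proof.
move=> qD qZ qE; pose f x : R[i]^o := q x +i* - q ('i%C *: x).
have q0 : q 0 = 0 by have := qZ 0 0; rewrite scale0r mul0r.
have qN x : q (- x) = - q x by apply: (@addrI _ (q x)); rewrite -qD !subrr.
have kE (a b : R) (x : E) : (a +i* b) *: x = a%:C *: x + b%:C *: ('i%C *: x).
  by rewrite scalerA -scalerDl; congr (_ *: _); simpc.
have ii (x : E) : 'i%C *: ('i%C *: x) = - x.
  by rewrite scalerA -expr2 sqr_i scaleN1r.
have iC (c : R) (x : E) : 'i%C *: (c%:C *: x) = c%:C *: ('i%C *: x).
  by rewrite !scalerA mulrC.
have lf : linear f.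
  move=> [a b] x y; rewrite /f kE !scalerDr !iC ii !qD !qZ qN.
  by rewrite /GRing.scale/=; simpc.
have ff x : `|f x| <= `|x|.
  have [->|fx0] := eqVneq (f x) 0; first by rewrite normr0.
  (* The phase u turns f(x) into its modulus, so |f(x)| = q(u x) <= |x|. *)
  pose u := (f x)^*%C / `|f x|.
  have u1 : `|u| = 1 by rewrite normrM normfV normr_id normcJ divff// normr_eq0.
  have fu : f (u *: x) = `|f x|.
    have := lf u x 0; rewrite addr0 (_ : f 0 = 0) ?addr0; last first.
      by rewrite /f scaler0 q0 oppr0.
    move=> ->; rewrite /GRing.scale/= /u mulrAC.
    by rewrite [_^*%C * _]mulrC -sqr_normc expr2 mulfK// normr_eq0.
  have := qE (u *: x); rewrite normrZ u1 mul1r.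
  by rewrite -[q _]/(complex.Re (f (u *: x))) fu RRe_real ?normr_real.
have bf : bounded_map f by exists 1 => x; rewrite mul1r; exact: ff.
by exists (mk_dual lf bf).
Qed.

Lemma norming_functional (x : E) :
  exists2 f : dual E, f x = `|x| & forall y, `|f y| <= `|y|.
Proof.
pose p y := complex.Re `|y|.
have pE (y : E) : (p y)%:C = `|y| by rewrite RRe_real ?normr_real.
have sp : sublinear p.
  split=> [y z|k y k0]; rewrite -lecR.
    by rewrite real_complexD !pE ler_normD.
  by rewrite real_complexM !pE normrZ ger0_norm// ler0c.
(* Starting from the infimum in the direction x forces q(-x) <= - |x|, hence q(x) = |x|. *)
have [r [sr rp rx]] := sublinear_dir x sp.
have [q [sq qr qmin]] := minimal_sublinear sr.
have qD := minimal_sublinearD sq qmin.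
have qN y : q (- y) = - q y.
  by apply: (@addrI _ (q y)); rewrite -qD !subrr sublinear0.
have [|y|f fq f1] := @complex_dual q qD.
- move=> k y; have [k0|k0] := leP 0 k; first exact: sublinearZ.
  apply: oppr_inj; rewrite -qN -mulNr -sublinearZ ?oppr_ge0 ?ltW//.
  by rewrite rmorphN scaleNr.
- by rewrite -pE lecR (le_trans (qr y)).
exists f => //.
have : complex.Re (f x) = p x.
  apply/eqP; rewrite fq eq_le (le_trans (qr x))//=.
  by rewrite -lerN2 -qN (le_trans (qr _)).
by move=> Ref; rewrite -pE; apply: complex_eq_Re; rewrite ?pE.
Qed.

End HahnBanach.

(** * Weak limits *)

Section GeneralizedLimit.
Variable R : realType.

(** The limit along an ultrafilter finer than the cofinite filter exists for bounded sequences by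
    compactness of [-M, M]. *)
Lemma real_ultralimit : exists L : (nat -> R) -> R,
  [/\ forall (a : R) (x y : nat -> R) (M N : R),
        (forall n, `|x n| <= M) -> (forall n, `|y n| <= N) ->
        L (fun n => a * x n + y n) = a * L x + L y,
      forall (x : nat -> R) (M : R), (forall n, `|x n| <= M) -> `|L x| <= M
    & forall (x : nat -> R) (l : R),
        (forall e, 0 < e -> exists N, forall n, (N <= n)%N -> `|x n - l| <= e) ->
        L x = l].
Proof.
have [U [UF leU]] := @ultraFilterLemma nat \oo _.
have cvgU (x : nat -> R) (M : R) : (forall n, `|x n| <= M) ->
    exists2 l : R, x @ U --> l & `|l| <= M.
  move=> xM; have := @segment_compact R (- M) M.
  move=> /(_ (x @ U)) [|l [lM xl]].
  - by apply: (@filterS _ U _ setT) filterT => n _ /=; rewrite in_itv/= -ler_norml.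
  - exists l; last by move: lM => /=; rewrite in_itv/= -ler_norml.
    move=> B lB; have [//|UB] := in_ultra_setVsetC (x @^-1` B) UF.
    by have [y [/= nBy By]] := xl (~` B) B UB lB.
have lim_eq (x : nat -> R) (l : R) : x @ U --> l -> lim (x @ U) = l.
  by move=> xl; apply: cvg_lim xl; exact: norm_hausdorff.
exists (fun x => lim (x @ U)); split.
- move=> a x y M N /cvgU[l xl _] /cvgU[l' yl' _].
  rewrite (lim_eq _ _ xl) (lim_eq _ _ yl'); apply: lim_eq.
  by apply: cvgD => //; apply: cvgM => //; exact: cvg_cst.
- by move=> x M /cvgU[l xl lM]; rewrite (lim_eq _ _ xl).
- move=> x l xl; apply: lim_eq; apply/cvgrPdist_le => e e0; apply: leU.
  by have [N Nx] := xl e e0; exists N => // n /= Nn; rewrite distrC; exact: Nx.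
Qed.

(** The factor 2 in the bound arises from treating real and imaginary parts separately. *)
Record generalized_limit (L : (nat -> R[i]) -> R[i]) : Prop := {
  glim_linear : forall (a : R[i]) (x y : nat -> R[i]) (M N : R),
    (forall n, `|x n| <= M%:C) -> (forall n, `|y n| <= N%:C) ->
    L (fun n => a * x n + y n) = a * L x + L y;
  glim_bound : forall (x : nat -> R[i]) (M : R),
    (forall n, `|x n| <= M%:C) -> `|L x| <= (M *+ 2)%:C;
  glim_lim : forall (x : nat -> R[i]) (l : R[i]),
    (forall e : R, 0 < e ->
      exists N, forall n, (N <= n)%N -> `|x n - l| <= e%:C) ->
    L x = l
}.

Lemma generalized_limit_exists : exists L, generalized_limit L.
Proof.
have [L [LD LM L0]] := real_ultralimit.
have ReM (z : R[i]) (M : R) : `|z| <= M%:C -> `|complex.Re z| <= M.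
  by move=> zM; rewrite -lecR (le_trans _ zM)//; exact: normc_ge_Re.
have ImM (z : R[i]) (M : R) : `|z| <= M%:C -> `|complex.Im z| <= M.
  move=> zM; have := @ReM (z * 'i%C) M.
  rewrite ReiNIm normrN; apply.
  by rewrite normrM complexiE normCi mulr1.
have LZ a x M : (forall n, `|x n| <= M) -> L (fun n => a * x n) = a * L x.
  move=> xM; have -> : (fun n => a * x n) = (fun n => a * x n + 0).
    by apply/funext => n; rewrite addr0.
  rewrite (LD a x (fun=> 0) M 0 xM) => [|n]; last by rewrite normr0.
  rewrite (L0 (fun=> 0) 0) ?addr0// => e e0; exists 0%N => n _.
  by rewrite subr0 normr0 ltW.
exists (fun x => L (fun n => complex.Re (x n)) +i* L (fun n => complex.Im (x n))).
split.
- move=> [a b] x y M N xM yN.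
  have Rx n := ReM _ _ (xM n). have Ix n := ImM _ _ (xM n).
  have Ry n := ReM _ _ (yN n). have Iy n := ImM _ _ (yN n).
  have bd (c : R) (u v : nat -> R) : (forall n, `|u n| <= M) ->
      (forall n, `|v n| <= N) -> forall n, `|c * u n + v n| <= `|c| * M + N.
    move=> uM vN n; rewrite (le_trans (ler_normD _ _))// lerD//.
    by rewrite normrM ler_wpM2l.
  have -> : (fun n => complex.Re ((a +i* b) * x n + y n)) =
      (fun n => a * complex.Re (x n) + (- b * complex.Im (x n) + complex.Re (y n))).
    apply/funext => n; case: (x n) (y n) => [x1 x2] [y1 y2]; simpc => /=.
    by rewrite ?mulNr ?addrA.
  have -> : (fun n => complex.Im ((a +i* b) * x n + y n)) =
      (fun n => a * complex.Im (x n) + (b * complex.Re (x n) + complex.Im (y n))).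
    apply/funext => n; case: (x n) (y n) => [x1 x2] [y1 y2]; simpc => /=.
    by rewrite addrA.
  rewrite (LD _ _ _ _ _ Rx (bd _ _ _ Ix Ry)) (LD _ _ _ _ _ Ix Ry).
  rewrite (LD _ _ _ _ _ Ix (bd _ _ _ Rx Iy)) (LD _ _ _ _ _ Rx Iy).
  by simpc; rewrite ?mulNr !addrA.
- move=> x M xM; rewrite [X in `|X|]complexE/= (le_trans (ler_normD _ _))//.
  have normR (u : R) : `|u%:C| = `|u|%:C.
    by rewrite normc_def/= expr0n addr0 sqrtr_sqr.
  rewrite normrM complexiE normCi mul1r !normR -real_complexD lecR mulr2n.
  by rewrite lerD// LM// => n; [exact: ReM|exact: ImM].
- move=> x [l1 l2] xl; congr (_ +i* _); apply: L0 => e /xl[N xN].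
  + exists N => n /xN/ReM; by case: (x n).
  + exists N => n /xN/ImM; by case: (x n).
Qed.

End GeneralizedLimit.

(** * Weak limits in an ideal of the bidual *)

Section WeakLimits.
Variables (R : realType) (A : cstarAlgType R).
Implicit Types (a b c e x y : A) (f : dual A).

Lemma dualB f x y : f (x - y) = f x - f y.
Proof. by rewrite -(scaleN1r y) dualD dualZ mulN1r. Qed.

Lemma dual_eq x y : (forall f, f x = f y) -> x = y.
Proof.
move=> fxy; apply/eqP; rewrite -subr_eq0 -normr_eq0.
have [f <- _] := norming_functional (x - y).
by rewrite dualB fxy subrr.
Qed.

Variable L : (nat -> R[i]) -> R[i].
Hypothesis limL : generalized_limit L.

Lemma glim_eventually (u : nat -> R[i]) l N :
  (forall n, (N <= n)%N -> u n = l) -> L u = l.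
Proof.
move=> ul; apply: (glim_lim limL) => e e0; exists N => n /ul ->.
by rewrite subrr normr0 ler0c ltW.
Qed.

Lemma glim_dual (f : nat -> dual A) (r : nat -> A) (M : R) :
    (forall n x, `|f n x| <= `|x|) -> (forall n, `|r n| <= M%:C) ->
  exists F : dual A, forall x, F x = L (fun n => f n (r n ** x)).
Proof.
move=> f1 rM.
have fM x n : `|f n (r n ** x)| <= (M * complex.Re `|x|)%:C.
  rewrite real_complexM (RRe_real (normr_real _)) (le_trans (f1 _ _))//.
  by rewrite (le_trans (amul_norm _ _))// ler_wpM2r.
have lF : linear (fun x => L (fun n => f n (r n ** x)) : R[i]^o).
  move=> k x y; rewrite -(glim_linear limL _ (fM x) (fM y)); congr L.
  by apply/funext => n; rewrite amul_linearr dual_linear.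
have bF : bounded_map (fun x => L (fun n => f n (r n ** x)) : R[i]^o).
  exists (M *+ 2) => x; rewrite (le_trans (glim_bound limL (fM x)))//.
  by rewrite -[`|x|](RRe_real (normr_real _)) -real_complexM lecR mulrnAl.
by exists (mk_dual lF bF).
Qed.

Hypothesis idA : two_sided_ideal (range (@bidual_emb R A)).

(** The map sending f to L (f (x n)) is an element P of the bidual, and (a P)(f) = L (f (a x n)).
    The ideal property places a P in A. *)
Lemma weak_limit a (x : nat -> A) (M : R) : (forall n, `|x n| <= M%:C) ->
  exists c, forall f, f c = L (fun n => f (a ** x n)).
Proof.
move=> xM.
have fxM f n : `|f (x n)| <= (complex.Re `|f| * M)%:C.
  rewrite real_complexM (RRe_real (normr_real _)) (le_trans (dual_le_norm _ _))//.
  by rewrite ler_wpM2l.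
have lP : linear (fun f => L (fun n => f (x n)) : R[i]^o).
  by move=> k f g; rewrite -(glim_linear limL _ (fxM f) (fxM g)).
have bP : bounded_map (fun f => L (fun n => f (x n)) : R[i]^o).
  exists (M *+ 2) => f; rewrite (le_trans (glim_bound limL (fxM f)))//.
  rewrite -[`|f|](RRe_real (normr_real _)) -real_complexM lecR.
  by rewrite mulrnAl mulrC.
have [_ _ /(_ _ (mk_dual lP bP) (ex_intro2 _ _ a I erefl))] := idA.
move=> [[c _ ca] _]; exists c => f.
by have := congr1 (fun P : dual (dual A) => P f) ca.
Qed.

Lemma projection_norm e : projection e -> `|e| <= 1.
Proof.
move=> [se ee]; have := cstar_norm e; rewrite se ee expr2 => eE.
have [->|e0] := eqVneq e 0; first by rewrite normr0.
by rewrite -(ler_pM2l (_ : 0 < `|e|)) ?normr_gt0// -eE mulr1.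
Qed.

Lemma projection_norm1 e : projection e -> e <> 0 -> `|e| = 1.
Proof.
move=> [se ee] /eqP e0; have := cstar_norm e; rewrite se ee expr2 => eE.
by apply: (@mulfI _ `|e|); rewrite ?normr_eq0// mulr1.
Qed.

(* Otherwise put [r n = e n - e n.+1], choose norm-one functionals [f n] with
   [f n (r n) = 1], and let [F x = lim_n f n (r n x)]. Then [F (e k) = 1] for all
   [k], while [F] vanishes at the weak limit of the [e k]. *)
Lemma projection_dcc (e : nat -> A) : (forall n, projection (e n)) ->
  (forall n, e n ** e n.+1 = e n.+1) -> exists n, e n.+1 = e n.
Proof.
move=> pe edec; apply: contrapT => estrict.
have le_e m n : (m <= n)%N -> e m ** e n = e n.
  move=> /subnK <-; elim: (n - m)%N => [|k IH]; first by rewrite add0n; case: (pe m).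
  by rewrite addSn -edec amulA IH.
have le_e' m n : (m <= n)%N -> e n ** e m = e n.
  move=> mn; have [se _] := pe n; have [se' _] := pe m.
  by rewrite -se -[in LHS]se' -astarM le_e.
pose r n := e n - e n.+1.
have r0 n : r n <> 0.
  by move=> /eqP; rewrite subr_eq0 => /eqP ee; apply: estrict; exists n.
have re n k : (k <= n)%N -> r n ** e k = r n.
  by move=> kn; rewrite /r amulBl !le_e'// leqW.
have re0 n k : (n < k)%N -> r n ** e k = 0.
  by move=> nk; rewrite /r amulBl !le_e ?subrr// ltnW.
have pr n : projection (r n).
  split; first by rewrite /r astarB; case: (pe n) => -> _; case: (pe n.+1) => -> _.
  by rewrite [X in _ ** X]/r amulBr re// re0// subr0.
have /choice[f fP] n : exists f : dual A, f (r n) = 1 /\ forall x, `|f x| <= `|x|.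
  have [f fr f1] := norming_functional (r n).
  by exists f; rewrite fr (projection_norm1 (pr n)).
have [F FE] :=
  @glim_dual f r 1 (fun n => (fP n).2) (fun n => projection_norm (pr n)).
have [d dE] := @weak_limit (e 0%N) e 1 (fun n => projection_norm (pe n)).
have Fe k : F (e k) = 1.
  rewrite FE; apply: (@glim_eventually _ _ k) => n kn.
  by rewrite re//; case: (fP n).
(* As r n e k = 0 for k > n, each r n annihilates the weak limit d of the e k. *)
have rd n : r n ** d = 0.
  apply: dual_eq => g; rewrite dual0 -[LHS]/(dual_act g (r n) d) dE.
  apply: (@glim_eventually _ _ n.+1) => k nk.
  by rewrite /= le_e// re0// dual0.
have : F d = 1 by rewrite dE; apply: (@glim_eventually _ _ 0%N) => n _; rewrite le_e.
rewrite FE (@glim_eventually _ 0 0%N) => [/eqP|n _]; last by rewrite rd dual0.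
by rewrite eq_sym oner_eq0.
Qed.

End WeakLimits.

(** * Projections *)

Section Powers.
Variables (R : realType) (A : cstarAlgType R) (a : A).
Hypothesis sa : astar a = a.
Implicit Types (p q : {poly R}).

(* [apow n] is [a ^+ n.+1] and [ev p] is [a p(a)], as [A] has no unit. *)
Definition apow n := iter n (amul a) a.

Definition ev p : A := \sum_(i < size p) (p`_i)%:C *: apow i.

Lemma apowD m n : apow m ** apow n = apow (m + n).+1.
Proof. by elim: m => [|m IH] //=; rewrite -amulA IH. Qed.

Lemma apow_star n : astar (apow n) = apow n.
Proof.
elim: n => [|n IH] //=; rewrite astarM IH sa -[a in LHS]/(apow 0) apowD.
by rewrite addn0.
Qed.

Lemma evE n p : (size p <= n)%N -> ev p = \sum_(i < n) (p`_i)%:C *: apow i.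
Proof.
move=> pn; rewrite /ev (big_ord_widen n (fun i => (p`_i)%:C *: apow i))// big_mkcond.
apply: eq_bigr => i _; case: ifPn => //; rewrite -leqNgt => /(nth_default 0) ->.
by rewrite scale0r.
Qed.

Lemma evD p q : ev (p + q) = ev p + ev q.
Proof.
set n := maxn (size p) (size q).
rewrite (@evE n _ (size_polyD _ _)) (@evE n p) ?leq_maxl// (@evE n q) ?leq_maxr//.
by rewrite -big_split/=; apply: eq_bigr => i _; rewrite coefD real_complexD scalerDl.
Qed.

Lemma evZ (k : R) p : ev (k *: p) = k%:C *: ev p.
Proof.
rewrite (@evE (size p) _ (size_scale_leq _ _)) scaler_sumr.
by apply: eq_bigr => i _; rewrite coefZ real_complexM scalerA.
Qed.

Lemma ev0 : ev 0 = 0. Proof. by rewrite /ev size_poly0 big_ord0. Qed.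

Lemma evN p : ev (- p) = - ev p.
Proof. by apply: (@addrI _ (ev p)); rewrite -evD !subrr ev0. Qed.

Lemma evB p q : ev (p - q) = ev p - ev q.
Proof. by rewrite evD evN. Qed.

Lemma evXn n : ev 'X^n = apow n.
Proof.
rewrite (@evE n.+1) ?size_polyXn// big_ord_recr/= coefXn eqxx scale1r big1 ?add0r//.
by move=> i _; rewrite coefXn ltn_eqF// scale0r.
Qed.

Lemma poly_monomial_ind (P : {poly R} -> Prop) :
  P 0 -> (forall p q, P p -> P q -> P (p + q)) ->
  (forall (k : R) n, P (k *: 'X^n)) -> forall p, P p.
Proof. by move=> P0 PD PX p; rewrite -[p]coefK poly_def; exact: big_ind. Qed.

Lemma ev_star p : astar (ev p) = ev p.
Proof.
elim/poly_monomial_ind: p => [|p q Ep Eq|k n]; first by rewrite ev0 astar0.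
  by rewrite evD astarD Ep Eq.
by rewrite evZ evXn astarZ conjc_real apow_star.
Qed.

(** Each [ev] carries a factor a, so the product carries two: hence the extra ['X]. *)
Lemma evM p q : ev p ** ev q = ev ('X * p * q).
Proof.
elim/poly_monomial_ind: p => [|p p' Ep Ep'|k n].
- by rewrite mulr0 mul0r ev0 amul0l.
- by rewrite mulrDr mulrDl !evD amulDl Ep Ep'.
elim/poly_monomial_ind: q => [|q q' Eq Eq'|l m].
- by rewrite mulr0 ev0 amul0r.
- by rewrite mulrDr !evD amulDr Eq Eq'.
rewrite -!scalerAr -scalerAl scalerA -exprS -exprD !evZ !evXn amulZl amulZr apowD.
by rewrite scalerA real_complexM mulrC.
Qed.

(** For z = x + i y, z - z^* = 2 i y, and z^* has the norm of z. *)
Lemma imag_part_le (x y : A) : astar x = x -> astar y = y ->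
  `|y| <= `|x + 'i%C *: y|.
Proof.
move=> sx sy; pose z := x + 'i%C *: y.
have zE : z - astar z = ('i%C *+ 2) *: y.
  rewrite /z astarD astarZ sx sy (_ : conjc 'i%C = - 'i%C); last by simpc.
  by rewrite scaleNr opprB addrC addrA subrK -mulr2n scalerMnl.
have : `|z - astar z| <= `|z| + `|z|.
  by rewrite (le_trans (ler_normB _ _))// astar_norm.
rewrite zE normrZ normrMn complexiE normCi -mulr2n mulrnAl mul1r.
by rewrite ler_pMn2r.
Qed.

(** In the C*-identity the cross terms cancel, because polynomials in a commute. *)
Lemma ev_normC p q :
  `|ev p + 'i%C *: ev q| ^+ 2 = `|ev ('X * (p ^+ 2 + q ^+ 2))|.
Proof.
rewrite -cstar_norm; congr `|_|.
rewrite astarD astarZ !ev_star (_ : conjc 'i%C = - 'i%C); last by simpc.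
rewrite !(amulDl, amulDr) !(amulZl, amulZr) !evM.
rewrite scalerA mulNr -expr2 sqr_i opprK scale1r.
rewrite (_ : 'X * q * p = 'X * p * q); last by ring.
by rewrite scaleNr addrA addrK -evD; congr ev; ring.
Qed.

Hypothesis na : `|a| = 1.

Lemma apow_norm n : `|apow n| <= 1.
Proof.
elim: n => [|n IH]; first by rewrite /= na.
by rewrite (le_trans (amul_norm _ _))// na mul1r.
Qed.

(** [apow 2] is a^3. The C*-identity gives |a^2| = |a^4| = 1, and |a^4| <= |a| |a^3|. *)
Lemma apow2_norm : `|apow 2| = 1.
Proof.
have n1 : `|apow 1| = 1.
  by rewrite -[apow 1]/(a ** a) -[a in a ** _]sa cstar_norm na expr1n.
have n3 : `|apow 3| = 1.
  by rewrite -[apow 3](apowD 1 1) -[X in X ** _]apow_star cstar_norm n1 expr1n.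
apply/eqP; rewrite eq_le apow_norm -n3 -[apow 3]/(a ** apow 2).
by rewrite (le_trans (amul_norm _ _))// na mul1r.
Qed.

(* [(h + h^2)^2 = (h - h^2)^2 + (2 a^3)^2] for [h = a^2], and
   [|s^2 + y^2| = |s + i y|^2 >= |y|^2] for commuting self-adjoint [s], [y]. *)
Lemma ev_XX3_norm : 2 <= `|ev ('X + 'X^3)|.
Proof.
have := imag_part_le (ev_star ('X - 'X^3)) (ev_star (2 *: 'X^2)).
rewrite -ler_sqr ?nnegrE// ev_normC.
rewrite (_ : 'X * _ = 'X * ('X + 'X^3) * ('X + 'X^3)); last first.
  by rewrite scaler_nat; ring.
rewrite -evM -[X in X ** _]ev_star cstar_norm ler_sqr ?nnegrE//.
rewrite evZ evXn normrZ apow2_norm mulr1 normc_def/= expr0n addr0 sqrtr_sqr.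
by rewrite normr_nat rmorph_nat.
Qed.

Variable f : dual A.
Hypothesis f1 : forall x, `|f x| <= `|x|.

Let phi p : R := complex.Re (f (ev p)).
Let psi p : R := complex.Im (f (ev p)).

Lemma phiD p q : phi (p + q) = phi p + phi q.
Proof. by rewrite /phi evD dualD; case: (f _) (f _) => [? ?] []. Qed.

Lemma phiZ k p : phi (k *: p) = k * phi p.
Proof. by rewrite /phi evZ dualZ; case: (f _) => [? ?] /=; rewrite mul0r subr0. Qed.

Lemma phi_le p (M : R) : `|ev p| <= M%:C -> phi p <= M.
Proof.
move=> pM; rewrite /phi -lecR (le_trans _ (le_trans (f1 _) pM))//.
by rewrite (le_trans _ (normc_ge_Re _))// lecR ler_norm.
Qed.

Lemma phiXn_le n : phi 'X^n <= 1.
Proof. by apply: phi_le; rewrite evXn; exact: apow_norm. Qed.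

(* [u = x - t^2 x b^2 / 2 + i t x b] has norm [1 + O(t^4)], since
   [|u|^2 = |x^2 (1 + t^4 b^4 / 4)|]. *)
Lemma phi_expansion b : phi 'X = 1 -> exists2 K : R, 0 <= K & forall t : R,
  1 - t ^+ 2 / 2 * phi ('X * b ^+ 2) - t * psi ('X * b) <= 1 + t ^+ 4 * K.
Proof.
move=> phi1; pose K := complex.Re `|ev ('X^3 * b ^+ 4)|.
have KE : K%:C = `|ev ('X^3 * b ^+ 4)| by rewrite (RRe_real (normr_real _)).
have K0 : 0 <= K by rewrite -ler0c KE.
exists K => // t.
pose g := 'X - (t ^+ 2 / 2) *: ('X * b ^+ 2).
pose u := ev g + 'i%C *: ev (t *: ('X * b)).
have -> : 1 - t ^+ 2 / 2 * phi ('X * b ^+ 2) - t * psi ('X * b) = complex.Re (f u).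
  rewrite /u dualD dualZ evZ dualZ evB evZ dualB dualZ.
  rewrite -[X in X - _ - _]phi1 /phi /psi.
  move: (f (ev 'X)) (f (ev ('X * b ^+ 2))) (f (ev ('X * b))) => [? ?] [? ?] [? ?].
  by simpc => /=; ring.
have t4K : 0 <= t ^+ 4 * K by rewrite mulr_ge0// exprn_even_ge0.
rewrite -lecR (le_trans (_ : _ <= `|f u|))//.
  by rewrite (le_trans _ (normc_ge_Re _))// lecR ler_norm.
rewrite (le_trans (f1 _))// -ler_sqr ?nnegrE ?ler0c ?addr_ge0//.
rewrite ev_normC (_ : 'X * _ = 'X^3 + (t ^+ 4 / 4) *: ('X^3 * b ^+ 4)); last first.
  rewrite /g; pose d := t / 2.
  have -> : t = d *+ 2 by rewrite /d; field.
  have -> : (d *+ 2) ^+ 2 / 2 = d ^+ 2 *+ 2 by field.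
  have -> : (d *+ 2) ^+ 4 / 4 = d ^+ 4 *+ 4 by field.
  by rewrite -!mul_polyC !polyCMn !polyC_exp; ring.
rewrite evD evZ (le_trans (ler_normD _ _))// normrZ -KE evXn.
rewrite (le_trans (lerD (apow_norm _) (lexx _)))//.
rewrite ger0_norm ?ler0c ?divr_ge0 ?exprn_even_ge0//.
rewrite -real_complexM -(rmorph1 (@real_complex R)) -real_complexD -rmorphXn lecR.
rewrite mulrAC; move: (t ^+ 4 * K) t4K => y y0; nra.
Qed.

(** In [phi_expansion] the term in [psi] cancels between t and -t, leaving - v <= 2 t^2 K, false for
    small t if v < 0. *)
Lemma phi_ge0 b : phi 'X = 1 -> 0 <= phi ('X * b ^+ 2).
Proof.
move=> phi1; have [K K0 bK] := phi_expansion b phi1.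
set v := phi _ in bK *; rewrite leNgt; apply/negP => v0.
(* With t^2 = s, 2 s K = - v K / (2 (K + 1)) < - v; K + 1 avoids division by zero. *)
pose s := - v / (4 * (K + 1)).
have s0 : 0 < s by rewrite divr_gt0 ?oppr_gt0// mulr_gt0// ltr_wpDl.
pose t := Num.sqrt s.
have t2 : t ^+ 2 = s by rewrite sqr_sqrtr// ltW.
have t4 : t ^+ 4 = s ^+ 2 by rewrite (exprM t 2 2) t2.
have sE : s * (4 * (K + 1)) = - v.
  by rewrite divfK// gt_eqF// mulr_gt0// ltr_wpDl.
have := lerD (bK t) (bK (- t)).
rewrite !sqrrN (_ : (- t) ^+ 4 = t ^+ 4); last by ring.
rewrite t4 t2 => h.
have {h} : s * (- v) <= s * (2 * s * K) by lra.
by rewrite ler_pM2l// -sE; nra.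
Qed.

(* Positivity for [b = (1 - x^2) + s x^(2j)] gives a Cauchy-Schwarz inequality;
   [phi (x (1 - x^2)^2) <= 0] is its degenerate case. *)
Lemma phi_odd_powers : phi 'X = 1 -> phi 'X^3 = 1 -> forall j, phi 'X^(j.*2.+1) = 1.
Proof.
move=> phi1 phi3; elim=> [|j IH]; first exact: phi1.
(* The coefficient - w makes the linear term - 2 w^2, while the quadratic one is at most w^2; so 0
   <= - w^2. *)
set u := phi 'X^(j.*2.+1) in IH; set v := phi _; pose w := u - v.
have := phi_ge0 (1 - 'X^2 + (- w) *: 'X^(j.*2)) phi1.
have -> : 'X * (1 - 'X^2 + (- w) *: 'X^(j.*2)) ^+ 2 =
    'X + (-2) *: 'X^3 + 'X^5 + (- w *+ 2) *: 'X^(j.*2.+1) +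
    (w *+ 2) *: 'X^(j.+1.*2.+1) + w ^+ 2 *: 'X^((j.*2 + j.*2).+1) :> {poly R}.
  have -> : 'X^(j.*2.+1) = 'X * 'X^(j.*2) :> {poly R} by rewrite exprS.
  have -> : 'X^(j.+1.*2.+1) = 'X^3 * 'X^(j.*2) :> {poly R} by rewrite -exprD.
  have -> : 'X^((j.*2 + j.*2).+1) = 'X * 'X^(j.*2) * 'X^(j.*2) :> {poly R}.
    by rewrite exprS exprD mulrA.
  by rewrite -!mul_polyC !(polyCMn, polyC_exp, polyCN); ring.
rewrite !(phiD, phiZ) phi1 phi3 -/u -/v.
have := phiXn_le 5; have := phiXn_le (j.*2 + j.*2).+1.
move: (phi 'X^5) (phi _) => x5 xj xj1 x51 h.
have w2 := sqr_ge0 w.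
have /eqP : w ^+ 2 = 0.
  apply/eqP; rewrite eq_le w2 andbT.
  have : w ^+ 2 * xj <= w ^+ 2 by rewrite ler_piMr.
  have : w ^+ 2 = w * u - w * v by rewrite -mulrBr expr2.
  lra.
by rewrite sqrf_eq0 subr_eq0 IH => /eqP.
Qed.

End Powers.

Section SpectralProjection.
Variables (R : realType) (A : cstarAlgType R) (a : A).
Hypotheses (sa : astar a = a) (na : `|a| = 1).

(** A functional norming a^2 + a^4, whose norm is at least 2, must be 1 at both; [phi_odd_powers]
    gives the other even powers. *)
Lemma even_powers_functional : exists2 f : dual A,
  forall x, `|f x| <= `|x| & forall j, f (apow a j.*2.+1) = 1.
Proof.
have [f fx f1] := norming_functional (ev a ('X + 'X^3)).
exists f => // j.
pose phi p := complex.Re (f (ev a p)).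
have phi_sum : 2 <= phi 'X + phi 'X^3.
  rewrite -(phiD a f) fx -lecR (RRe_real (normr_real _)).
  by rewrite (le_trans _ (ev_XX3_norm sa na))// rmorph_nat.
have phiX := phiXn_le na f1 1; have phiX3 := phiXn_le na f1 3.
rewrite expr1 in phiX.
have phi1 : phi 'X = 1 by apply/eqP; rewrite eq_le phiX/=; lra.
have phi3 : phi 'X^3 = 1 by apply/eqP; rewrite eq_le phiX3/=; lra.
have := phi_odd_powers sa na f1 phi1 phi3 j; rewrite evXn => phij.
apply: (complex_eq_Re phij); rewrite (le_trans (f1 _))//; exact: apow_norm.
Qed.

End SpectralProjection.

(** * Cesaro means and their weak limit *)

Section SpectralProjection.
Variables (R : realType) (A : cstarAlgType R) (a : A).
Hypotheses (sa : astar a = a) (na : `|a| = 1).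
Variable L : (nat -> R[i]) -> R[i].
Hypothesis limL : generalized_limit L.
Hypothesis idA : two_sided_ideal (range (@bidual_emb R A)).

Let h := apow a 1.

(** As [apow a j.*2.+1] is h^(j+1), this is the mean of h, ..., h^(n+1). *)
Definition cesaro n : A := n.+1%:R^-1 *: \sum_(j < n.+1) apow a j.*2.+1.

Lemma amul_sumr (b : A) n (F : nat -> A) :
  b ** (\sum_(j < n) F j) = \sum_(j < n) b ** F j.
Proof. by elim/big_rec2: _ => [|i x y _ <-]; rewrite ?amul0r// amulDr. Qed.

Lemma amul_suml (b : A) n (F : nat -> A) :
  (\sum_(j < n) F j) ** b = \sum_(j < n) F j ** b.
Proof. by elim/big_rec2: _ => [|i x y _ <-]; rewrite ?amul0l// amulDl. Qed.

Lemma apow_even j : h ** apow a j.*2.+1 = apow a j.+1.*2.+1.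
Proof. by rewrite /h apowD. Qed.

Lemma cesaro_comm n : h ** cesaro n = cesaro n ** h.
Proof.
rewrite /cesaro amulZr amulZl (amul_sumr _ _ (fun j => apow a j.*2.+1)).
rewrite (amul_suml _ _ (fun j => apow a j.*2.+1)); congr (_ *: _).
by apply: eq_bigr => j _; rewrite /h !apowD addnC.
Qed.

Lemma cesaro_norm n : `|cesaro n| <= 1.
Proof.
rewrite normrZ normfV normr_nat ler_pdivrMl ?ltr0n// mulr1.
rewrite (le_trans (ler_norm_sum _ _ _))//.
apply: (@le_trans _ _ (\sum_(j < n.+1) 1)); last by rewrite sumr_const card_ord.
by apply: ler_sum => j _; exact: apow_norm.
Qed.

Lemma cesaro_shift n : h ** cesaro n - cesaro n =
  n.+1%:R^-1 *: (apow a n.+1.*2.+1 - h).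
Proof.
rewrite /cesaro amulZr -scalerBr (amul_sumr _ _ (fun j => apow a j.*2.+1)).
congr (_ *: _); rewrite -sumrB.
transitivity (\sum_(j < n.+1) (apow a j.+1.*2.+1 - apow a j.*2.+1)).
  by apply: eq_bigr => j _; rewrite apow_even.
rewrite -(big_mkord xpredT (fun j => apow a j.+1.*2.+1 - apow a j.*2.+1)).
by rewrite telescope_sumr.
Qed.

Lemma cesaro_fixed n c : h ** c = c -> cesaro n ** c = c.
Proof.
move=> hc; have pc j : apow a j.*2.+1 ** c = c.
  by elim: j => [//|j IH]; rewrite -apow_even -amulA IH.
rewrite /cesaro amulZl (amul_suml _ _ (fun j => apow a j.*2.+1)).
rewrite (eq_bigr (fun=> c)) => [|j _]; last exact: pc.
rewrite sumr_const card_ord -[c *+ _]scaler_nat scalerA.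
by rewrite mulVf ?scale1r// pnatr_eq0.
Qed.

(** Right-sided counterpart of [dual_act], for multiplying weak limits on the right. *)
Lemma dual_mulr (f : dual A) (b : A) : exists g : dual A, forall x, g x = f (x ** b).
Proof.
have lf : linear (fun x => f (x ** b) : R[i]^o).
  by move=> k x y; rewrite amul_linearl dual_linear.
have bf : bounded_map (fun x => f (x ** b) : R[i]^o).
  exists (complex.Re (`|f| * `|b|)) => x.
  rewrite RRe_real ?realM ?normr_real// (le_trans (dual_le_norm _ _))//.
  by rewrite -mulrA ler_wpM2l// mulrC amul_norm.
by exists (mk_dual lf bf).
Qed.

(* [c] is the weak limit of [h] times the Cesaro means of the powers of [h = a^2],
   hence morally the spectral projection of [h] at [1]. *)
Lemma spectral_projection : exists c : A,
  [/\ projection c, c <> 0 & a ** a ** c = c].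
Proof.
have [c cE] := weak_limit limL idA h cesaro_norm.
have hc : h ** c = c.
  have fM (f : dual A) n : `|f (h ** cesaro n)| <= (complex.Re `|f|)%:C.
    rewrite (RRe_real (normr_real _)) (le_trans (dual_le_norm _ _))// ler_piMr//.
    by rewrite (le_trans (amul_norm _ _))// mulr_ile1// ?cesaro_norm ?apow_norm.
  apply: dual_eq => f; apply/eqP; rewrite -subr_eq0; apply/eqP.
  rewrite -[f (h ** c)]/(dual_act f h c) !cE addrC -mulN1r.
  rewrite -(glim_linear limL _ (fM f) (fM (dual_act f h))).
  apply: (glim_lim limL) => e e0; pose M := complex.Re `|f|.
  have ME : M%:C = `|f| by rewrite (RRe_real (normr_real _)).
  have M0 : 0 <= M by rewrite -ler0c ME.
  (* By telescoping, h moves the n-th mean by at most 2 / (n + 1) in norm. *)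
  exists (Num.bound (M * 2 / e)) => n nN.
  rewrite subr0 mulN1r addrC -[dual_act f h _]/(f (h ** (h ** cesaro n))).
  rewrite -dualB -amulBr cesaro_shift (le_trans (dual_le_norm _ _))//.
  rewrite -ME (@le_trans _ _ ((M * (n.+1%:R^-1 * 2))%:C))//.
    rewrite real_complexM ler_wpM2l ?ler0c// (le_trans (amul_norm _ _))//.
    rewrite -[leRHS]mul1r ler_pM//; first exact: apow_norm.
    rewrite normrZ normfV normr_nat real_complexM fmorphV !rmorph_nat.
    rewrite ler_wpM2l ?invr_ge0//.
    by rewrite (le_trans (ler_normB _ _))// -[2]/(1 + 1) lerD// apow_norm.
  rewrite lecR mulrCA mulrC ler_pdivrMr ?ltr0n// -ler_pdivrMl// mulrC.
  rewrite (le_trans (ltW (archi_boundP _)))//.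
    by rewrite divr_ge0 ?mulr_ge0// ltW.
  by rewrite ler_nat (leq_trans nN).
have ch : c ** h = c.
  rewrite -[RHS]hc; apply: dual_eq => f; have [g gE] := dual_mulr f h.
  rewrite -gE -[RHS]/(dual_act f h c) !cE; congr L; apply/funext => n.
  by rewrite gE /= -amulA -cesaro_comm.
have sh : astar h = h by exact: apow_star.
have hc' : h ** astar c = astar c by rewrite -[in LHS]sh -astarM ch.
(* Since h fixes c^*, so do all the means and their limit; then c^* = c c^* is self-adjoint. *)
have cc' : c ** astar c = astar c.
  apply: dual_eq => f; have [g gE] := dual_mulr f (astar c).
  rewrite -gE cE; apply: (glim_eventually limL (N := 0)) => n _.
  by rewrite gE -amulA cesaro_fixed// hc'.
have sc : astar c = c by rewrite -[in RHS](astarK c) -cc' astarM astarK.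
exists c; split => //; first by split => //; rewrite -[X in _ ** X]sc cc'.
(* This f is 1 on every power of h, hence on h times each mean, hence at c. *)
have [f f1 fa] := even_powers_functional sa na.
move=> c0; have : f c = 1.
  rewrite cE; apply: (glim_eventually limL (N := 0)) => n _.
  rewrite /cesaro amulZr dualZ (amul_sumr _ _ (fun j => apow a j.*2.+1)).
  have fs : f (\sum_(j < n.+1) h ** apow a j.*2.+1) = n.+1%:R.
    elim: n.+1 => [|m IH]; first by rewrite big_ord0 dual0.
    by rewrite big_ord_recr/= dualD IH apow_even fa -natr1.
  by rewrite fs mulVf// pnatr_eq0.
by rewrite c0 dual0 => /eqP; rewrite eq_sym oner_eq0.
Qed.

End SpectralProjection.

(** * Existence of minimal projections *)

Section MinimalProjections.
Variables (R : realType) (A : cstarAlgType R).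
Hypothesis idA : two_sided_ideal (range (@bidual_emb R A)).
Implicit Types (a b c e g p q r x y : A).

(** Apply [spectral_projection] to g / |g|; then k = |g|^2. *)
Lemma selfadjoint_projection g : astar g = g -> g <> 0 ->
  exists k c, [/\ projection c, c <> 0, k != 0 & g ** g ** c = k *: c].
Proof.
move=> sg /eqP g0; pose n := complex.Re `|g|.
have nE : n%:C = `|g| by rewrite (RRe_real (normr_real _)).
have n0 : n%:C != 0 by rewrite nE normr_eq0.
pose a := (n^-1)%:C *: g.
have sa : astar a = a by rewrite astarZ conjc_real sg.
have na : `|a| = 1.
  by rewrite normrZ fmorphV normfV /= nE normr_id mulVf// normr_eq0.
have [L limL] := generalized_limit_exists R.
have [c [pc c0 aac]] := spectral_projection sa na limL idA.
exists (n%:C ^+ 2), c; split => //; first by rewrite expf_neq0.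
rewrite -[in RHS]aac /a !(amulZl, amulZr) !scalerA fmorphV/=.
by rewrite expr2 -invfM mulfV ?scale1r ?mulf_neq0.
Qed.

(** Self-adjoint elements of the corner have scalar squares; polarisation with e makes them scalar,
    and they span the corner. *)
Lemma indecomposable_minimal e : projection e -> e <> 0 ->
    (forall r, projection r -> r <> 0 -> e ** r = r -> r = e) ->
  minimal_projection e.
Proof.
move=> pe e0 emin; case: (pe) => se ee; split => //.
(* The projection c attached to g lies below e, so c = e and g^2 = k e. *)
have sq g : astar g = g -> e ** g = g -> exists k, g ** g = k *: e.
  move=> sg eg; have [->|g0] := pselect (g = 0).
    by exists 0; rewrite amul0l scale0r.
  have [k [c [pc c0 k0 ggc]]] := selfadjoint_projection sg g0.
  have ec : e ** c = c.
    by apply: (scalerI k0); rewrite -amulZr -ggc !amulA eg.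
  have ge : g ** e = g by rewrite -[in LHS]sg -se -astarM eg.
  by exists k; rewrite -[e](emin c pc c0 ec) -ggc (emin c pc c0 ec) -amulA ge.
have sa x : astar x = x -> e ** x = x -> exists k, x = k *: e.
  move=> sx ex; have [k1 k1E] := sq x sx ex.
  have xe : x ** e = x by rewrite -[in LHS]sx -se -astarM ex.
  have [||k2] := sq (x + e); rewrite ?astarD ?amulDr ?sx ?se ?ex ?ee//.
  (* From (x + e)^2 = x^2 + 2 x + e. *)
  rewrite !(amulDl, amulDr) xe ex ee k1E => k2E; exists ((k2 - k1 - 1) / 2).
  rewrite mulrC -scalerA !scalerBl -k2E scale1r.
  rewrite addrA [X in X - e]addrAC addrK -(addrA _ x x) addrAC subrr add0r.
  by rewrite -mulr2n -[x *+ 2]scaler_nat scalerA mulVf ?scale1r// pnatr_eq0.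
move=> x; set y := e ** x ** e.
have ey : e ** y = y by rewrite /y !amulA ee.
have esy : e ** astar y = astar y by rewrite -[X in X ** _]se -astarM /y -amulA ee.
have [||k uE] := sa (y + astar y).
- by rewrite astarD astarK addrC.
- by rewrite amulDr ey esy.
have [||l vE] := sa ('i%C *: (y - astar y)).
- rewrite astarZ astarB astarK (_ : conjc 'i%C = - 'i%C); last by simpc.
  by rewrite scaleNr -scalerN opprB.
- by rewrite amulZr amulBr ey esy.
(* 2 y = u - i v with u = y + y^* and v = i y - i y^*. *)
exists ((k - 'i%C * l) / 2).
rewrite mulrC -scalerA scalerBl -uE -scalerA -vE scalerA -expr2 sqr_i scaleN1r opprK.
rewrite addrACA subrr addr0 -mulr2n -[y *+ 2]scaler_nat scalerA.
by rewrite mulVf ?scale1r// pnatr_eq0.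
Qed.

(** Otherwise a strictly smaller projection could be chosen again and again, against
    [projection_dcc]. *)
Lemma minimal_projection_below e : projection e -> e <> 0 ->
  exists2 p, minimal_projection p & e ** p = p.
Proof.
move=> pe e0; apply: contrapT => nomin.
pose Q q := [/\ projection q, q <> 0 & e ** q = q].
have /choice[s sP] q : exists r, Q q -> [/\ Q r, q ** r = r & r <> q].
  (* The default 0 only makes the choice total. *)
  have [Qq|nQ] := pselect (Q q); last by exists 0.
  have [pq q0 eq] := Qq; apply: contrapT => nor; apply: nomin; exists q => //.
  apply: indecomposable_minimal => // r pr r0 qr; apply: contrapT => rq.
  apply: nor; exists r => _; split => //; split => //.
  by rewrite -qr amulA eq.
have Qs n : Q (iter n s e).
  elim: n => [|n IH]; first by split => //; case: pe.
  by have [] := sP _ IH.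
have [L limL] := generalized_limit_exists R.
have [||n] := @projection_dcc _ _ _ limL idA (fun n => iter n s e).
- by move=> n; have [] := Qs n.
- by move=> n; have [] := sP _ (Qs n).
by have [_ _] := sP _ (Qs n).
Qed.

(** For b = a^* a and p below c, a p = 0 would give k p = b^2 p = 0. *)
Lemma minimal_projection_exists a : a <> 0 ->
  exists2 p, minimal_projection p & a ** p <> 0.
Proof.
move=> a0; pose b := astar a ** a.
have sb : astar b = b by rewrite astarM astarK.
have b0 : b <> 0 by move=> /cstar_eq0.
have [k [c [pc c0 k0 bbc]]] := selfadjoint_projection sb b0.
have [p mp cp] := minimal_projection_below pc c0; exists p => // ap0.
have [_ p0 _] := mp; apply: p0; apply: (scalerI k0).
rewrite scaler0 -cp -amulZl -bbc -!amulA cp.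
by rewrite ap0 !amul0r.
Qed.

End MinimalProjections.

Theorem proposition3p3 (R : realType) (A : cstarAlgType R)
    (tau : dual (dual A) -> \bar R) :
  two_sided_ideal (range (@bidual_emb R A)) ->
  is_trace tau ->
  normal tau ->
  semifinite tau ->
  (forall a : A, positive a -> tau (bidual_emb a) = 0%E -> a = 0) ->
  forall Delta : A -> A, two_local_derivation Delta -> derivation Delta.
Proof.
move=> idA _ _ _ _ Delta locD.
exact: (two_local_derivation_derivation locD (minimal_projection_exists idA)).
Qed.
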